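(* Let $\{S(t): t\ge 0\}$ be a semigroup on a normed space $(X,\|\cdot\|)$ over $\mathbb{K}\in\{\mathbb{R},\mathbb{C}\}$ with a global attractor $\mathbf{A}$. Assume that for some $T>0$ and $\delta_0>0$ the map $S(T)$ is $C^1$ on the $\delta_0$-neighborhood $$B_{\delta_0}(\mathbf{A})=\bigcup_{x\in\mathbf{A}}B^{X}(x,\delta_0)$$ of $\mathbf{A}$, and that there exists $\lambda\in(0,\frac14)$ such that for any $y\in B_{\delta_0}(\mathbf{A})$ the derivative $D_yS(T)$ decomposes as $$D_yS(T)=K_y+C_y,\quad K_y\in\mathcal{L}(X)\text{ compact},\quad C_y\in\mathcal{L}(X),\ \|C_y\|<\lambda.$$ Then for any $\sigma\in(0,1-4\lambda)$ there exist $r_0>0$, $b_0>0$, $h\geq 1$ and a bounded absorbing set $\mathbf{B}\subset B_{\delta_0}(\mathbf{A})$ such that $S(T)\mathbf{B}\subseteq\mathbf{B}$ and the covering condition $$N^{X}(S(kT)\mathbf{B},q^{k}r_0)\le b_0h^{k},\quad k\in\mathbb{N},$$ holds with $q=\sigma+4\lambda\in(0,1)$ and $$h\le\Bigl(1+\frac{8\sqrt{n}M}{\sigma}\Bigr)^{\mathbf{n}},$$ where $$n=\sup_{y\in\mathbf{B}}\nu_\lambda(D_yS(T))\in\mathbb{N}_0,\qquad M=\sup_{y\in\mathbf{B}}\|D_yS(T)\|\in[0,\infty),$$ and $\mathbf{n}=n$ if $\mathbb{K}=\mathbb{R}$, $\mathbf{n}=2n$ if $\mathbb{K}=\mathbb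{C}$.
   Context: $\mathbb{N}=\{1,2,\dots\}$, $\mathbb{N}_0=\mathbb{N}\cup\{0\}$. A semigroup $\{S(t):t\ge0\}$ on $X$ is a family of (not necessarily linear) maps $S(t):X\to X$ with $S(t)S(s)=S(t+s)$ for $t,s\ge 0$ and $S(0)=I$; ''$t\ge 0$'' means throughout either $t\in[0,\infty)$ or $t\in\mathbb{N}_0$ (and $T$ belongs to the time set). $B^X(x,r)$ is the open ball in $X$; $\mathcal{L}(X)$ the bounded linear operators on $X$; $C^1$ means continuously Fréchet differentiable, with derivative $D_yS(T)\in\mathcal{L}(X)$ at $y$. Global attractor: a nonempty compact set $\mathbf{A}\subseteq X$ with $S(t)\mathbf{A}=\mathbf{A}$ for all $t\ge 0$ and $\lim_{t\to\infty}\sup_{x\in G}\inf_{y\in\mathbf{A}}\|S(t)x-y\|=0$ for every bounded $G\subseteq X$. Absorbing set: $\mathbf{B}\subseteq X$ such that for every bounded $G\subseteq X$ there is $t_G\ge 0$ with $S(t)G\subseteq\mathbf{B}$ for all $t\ge t_G$. For $y\in B_{\delta_0}(\mathbf{A})$, $\nu_\lambda(D_yS(T))$ is the minimal $m\in\mathbb{N}_0$ for which there is an $m$-dimensional linear subspace $F$ of $X$ with $$\sup_{w\in X,\ \|w\|\le1}\ \inf_{z\in F,\ \|z\|\le1}\|D_yS(T)(w-z)\|<2\lambda$$ (under the stated assumptions such an $m$ exists). $N^X(G,\varepsilon)$ is the minimal number of open $\varepsilon$-balls in $X$ centered at points of $G$ needed to cover $G$. *)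

(* Defs.v *)
From HB Require Import structures.
From mathcomp Require Import all_boot all_order all_algebra.
From mathcomp Require Import complex.
From mathcomp Require Import all_classical all_reals all_analysis.

Set Implicit Arguments.
Unset Strict Implicit.
Unset Printing Implicit Defensive.

Import Order.TTheory GRing.Theory Num.Theory.
Import numFieldNormedType.Exports.

Local Open Scope classical_set_scope.
Local Open Scope ring_scope.

Inductive scalar_kind := RealScalars | ComplexScalars.

Definition scalar_field (R : realType) (k : scalar_kind) : numFieldType :=
  match k with
  | RealScalars => R
  | ComplexScalars => R[i]
  end.

Definition real_dim (k : scalar_kind) : nat :=
  match k with
  | RealScalars => 1
  | ComplexScalars => 2
  end.

Definition real_part (R : realType) (k : scalar_kind) : scalar_field R k -> R :=
  match k return scalar_field R k -> R with
  | RealScalars => fun x => x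
  | ComplexScalars => fun z => complex.Re z
  end.

(* The norm of a [normedModType K] takes its values in [K]; over [R[i]] these
   are nonnegative reals seen as complex numbers, so taking the real part
   loses nothing. *)
Definition rnorm (R : realType) (k : scalar_kind)
    (X : normedModType (scalar_field R k)) (x : X) : R :=
  real_part `|x|.

(* The least element of a set of natural numbers, +oo if the set is empty. *)
Definition least (R : realType) (P : set nat) : \bar R :=
  ereal_inf [set m%:R%:E | m in P].

Definition time_set (R : realType) (J : set R) : Prop :=
  J = [set t | 0 <= t] \/ J = range (fun n : nat => n%:R).

Section normed_space.
Context {R : realType} {k : scalar_kind} {X : normedModType (scalar_field R k)}.

Definition oball (x : X) (r : R) : set X := [set y | rnorm (x - y) < r].

Definition oneighborhood (A : set X) (d : R) : set X :=
  \bigcup_(x in A) oball x d.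

(* The minimal number of open e-balls centered at points of G that cover G. *)
Definition covering_number (G : set X) (e : R) : \bar R :=
  least R [set m | exists c : 'I_m -> X,
    (forall i, G (c i)) /\ G `<=` \bigcup_i oball (c i) e].

Definition opnorm (f : X -> X) : \bar R :=
  ereal_sup [set (rnorm (f x))%:E | x in [set x | rnorm x <= 1]].

Definition compact_operator (f : X -> X) : Prop :=
  forall G : set X, bounded_set G -> precompact (f @` G).

Definition C1_on (U : set X) (f : X -> X) : Prop :=
  forall y, U y ->
    differentiable f y /\
    opnorm (fun w => 'd f z w - 'd f y w) @[z --> y] --> 0%E.

Definition subspace_of_dim (F : set X) (m : nat) : Prop :=
  exists e : 'I_m -> X,
    (forall a : 'I_m -> scalar_field R k,
       \sum_i a i *: e i = 0 -> forall i, a i = 0) /\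
    F = [set \sum_i a i *: e i | a in [set: 'I_m -> scalar_field R k]].

Definition nu (l : R) (L : X -> X) : \bar R :=
  least R [set m | exists2 F : set X, subspace_of_dim F m &
    let gap w := ereal_inf [set (rnorm (L (w - z)))%:E |
                             z in [set z | F z /\ rnorm z <= 1]] in
    (ereal_sup [set gap w | w in [set w | (rnorm w <= 1)%R]] < (2 * l)%:E)%E].

Definition semigroup (J : set R) (S : R -> X -> X) : Prop :=
  (forall x, S 0 x = x) /\
  (forall t s, J t -> J s -> forall x, S t (S s x) = S (t + s) x).

Definition distance (x : X) (A : set X) : \bar R :=
  ereal_inf [set (rnorm (x - y))%:E | y in A].

(* The attraction condition is void for G = set0, for which [ereal_sup]
   would give -oo instead of 0. *)
Definition global_attractor (J : set R) (S : R -> X -> X) (A : set X) : Prop :=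
  [/\ A !=set0, compact A,
      forall t, J t -> S t @` A = A &
      forall G : set X, bounded_set G -> G !=set0 ->
        ereal_sup [set distance (S t x) A | x in G]
          @[t --> within J (nbhs +oo)] --> 0%E].

Definition absorbing (J : set R) (S : R -> X -> X) (B : set X) : Prop :=
  forall G : set X, bounded_set G ->
    exists2 tG, J tG & forall t, J t -> tG <= t -> S t @` G `<=` B.

End normed_space.

(* Main.v *)
Require Import Defs.
From HB Require Import structures.
From mathcomp Require Import all_boot all_order all_algebra.
From mathcomp Require Import complex.
From mathcomp Require Import all_classical all_reals all_analysis.
From mathcomp Require Import ring lra.

(** Near a point [x], [S T] is its derivative [D] up to a small error, and [D]
    maps the unit ball within [2 lambda] of the image [D Z] of the unit ball [Z]
    of an [n]-dimensional subspace.  A maximal [sigma / 4]-separated subset of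
    [D Z] has at most [(1 + 8 M / sigma) ^ (real_dim k * n)] points, so that
    [S T] maps a ball of radius [r] into that many balls of radius
    [(sigma / 2 + 2 lambda) r], and moving the centers into the image doubles
    the radius.  Compactness of [A] makes [n], [M] and the error uniform on an
    [e]-neighborhood of [A].  The absorbing set consists of the points whose
    whole orbit under [S T] stays in that neighborhood; it is covered by
    finitely many balls of radius [2 e], and the estimate is iterated. *)

Set Implicit Arguments.
Unset Strict Implicit.
Unset Printing Implicit Defensive.

Import Order.TTheory GRing.Theory Num.Theory.
Import numFieldNormedType.Exports.

Local Open Scope classical_set_scope.
Local Open Scope ring_scope.

(** * The real numbers inside the scalar field *)

Section scalars.
Context {R : realType}.

Definition of_real (k : scalar_kind) : R -> scalar_field R k :=
  match k return R -> scalar_field R k with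
  | RealScalars => fun x => x
  | ComplexScalars => fun x => (x%:C)%C
  end.

Lemma of_real_is_zmod_morphism k : zmod_morphism (of_real k).
Proof. by case: k => x y //=; rewrite rmorphB. Qed.

Lemma of_real_is_monoid_morphism k : monoid_morphism (of_real k).
Proof. by case: k; split => // x y /=; rewrite rmorphM. Qed.

HB.instance Definition _ k :=
  GRing.isZmodMorphism.Build R (scalar_field R k) (of_real k)
    (of_real_is_zmod_morphism k).
HB.instance Definition _ k :=
  GRing.isMonoidMorphism.Build R (scalar_field R k) (of_real k)
    (of_real_is_monoid_morphism k).

Lemma of_real_le k x y : (of_real k x <= of_real k y) = (x <= y).
Proof. by case: k => //=; rewrite lecR. Qed.

Lemma of_real_lt k x y : (of_real k x < of_real k y) = (x < y).
Proof. by case: k => //=; rewrite ltcR. Qed.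

Lemma real_part_of_real k x : real_part (of_real k x) = x.
Proof. by case: k. Qed.

Lemma of_real_real_part k (z : scalar_field R k) :
  z \is Num.real -> of_real k (real_part z) = z.
Proof.
case: k z => //= -[a b] /= abr.
by have : (a +i* b)%C \is Num.real by []; rewrite complex_real => /eqP ->.
Qed.

Lemma norm_of_real k x : `|of_real k x| = of_real k `|x|.
Proof. by case: k => //=; rewrite normc_def /= expr0n addr0 sqrtr_sqr. Qed.

End scalars.


(** * The real-valued norm and the topology it describes *)

Section rnorm.
Context {R : realType} {k : scalar_kind} {X : normedModType (scalar_field R k)}.
Implicit Types (x y z : X) (s : R).

Lemma of_real_rnorm x : of_real k (rnorm x) = `|x|.
Proof. by rewrite of_real_real_part ?normr_real. Qed.

Lemma rnorm_le x s : (rnorm x <= s) = (`|x| <= of_real k s).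
Proof. by rewrite -of_real_rnorm of_real_le. Qed.

Lemma rnorm_lt x s : (rnorm x < s) = (`|x| < of_real k s).
Proof. by rewrite -of_real_rnorm of_real_lt. Qed.

Lemma rnorm_ge0 x : 0 <= rnorm x.
Proof. by rewrite -(of_real_le k) rmorph0 of_real_rnorm. Qed.

Lemma rnorm0 : rnorm (0 : X) = 0.
Proof. by rewrite /rnorm normr0 -(rmorph0 (of_real k)) real_part_of_real. Qed.

Lemma rnormN x : rnorm (- x) = rnorm x.
Proof. by rewrite /rnorm normrN. Qed.

Lemma rdistC x y : rnorm (x - y) = rnorm (y - x).
Proof. by rewrite -rnormN opprB. Qed.

Lemma rnormD x y : rnorm (x + y) <= rnorm x + rnorm y.
Proof. by rewrite -(of_real_le k) rmorphD /= !of_real_rnorm; exact: ler_normD. Qed.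

Lemma rnormB x y : rnorm (x - y) <= rnorm x + rnorm y.
Proof. by rewrite -[in leRHS](rnormN y) rnormD. Qed.

Lemma rdistD z x y : rnorm (x - y) <= rnorm (x - z) + rnorm (z - y).
Proof. by apply: le_trans (rnormD _ _); rewrite addrA subrK. Qed.

Lemma rnormZ s x : rnorm (of_real k s *: x) = `|s| * rnorm x.
Proof.
by rewrite /rnorm normrZ norm_of_real -of_real_rnorm -rmorphM !real_part_of_real.
Qed.

Lemma rnorm_sum (I : finType) (F : I -> X) :
  rnorm (\sum_i F i) <= \sum_i rnorm (F i).
Proof.
elim/big_rec2 : _ => [|i a b _ ab]; first by rewrite rnorm0.
by apply: le_trans (rnormD _ _) _; rewrite lerD2l.
Qed.

(** Radii of norm balls live in the scalar field, but a positive scalar is real and so equals its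
    own real part; hence real radii suffice. *)
Lemma rnorm_nbhsP x (P : X -> Prop) :
  nbhs x P <-> exists2 e, 0 < e & forall y, rnorm (x - y) < e -> P y.
Proof.
split=> [/nbhs_normP [e e0 eP]|[e e0 eP]].
  have ereal : e \is Num.real by exact: gtr0_real.
  exists (real_part e).
    by rewrite -(of_real_lt k) of_real_real_part// rmorph0.
  by move=> y; rewrite rnorm_lt of_real_real_part// => /eP.
apply/nbhs_normP; exists (of_real k e); first by rewrite /= -(rmorph0 (of_real k)) of_real_lt.
by move=> y /=; rewrite -rnorm_lt => /eP.
Qed.

Lemma open_oball x s : open (oball x s).
Proof.
rewrite openE => y xy; apply/rnorm_nbhsP.
exists (s - rnorm (x - y)); first by rewrite subr_gt0.
by move=> z yz; rewrite /oball /=; have := rdistD y x z; lra.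
Qed.

Lemma rnorm_bounded_setP (G : set X) :
  bounded_set G <-> exists s, forall x, G x -> rnorm x <= s.
Proof.
split=> [[M [Mr GM]]|[s Gs]].
  exists (real_part M + 1) => x Gx.
  rewrite rnorm_le; apply: GM => //.
  by rewrite -[ltLHS]of_real_real_part// of_real_lt ltrDl.
exists (of_real k s); split.
  by rewrite realE -!(rmorph0 (of_real k)) !of_real_le -realE num_real.
by move=> y sy x Gx /=; apply: le_trans (ltW sy); rewrite -rnorm_le Gs.
Qed.

End rnorm.

(** * Separated sets in finite-dimensional spaces *)

Section packing.
Context {R : realType}.

(** If [a / b] exceeded 1, Bernoulli's inequality would make its powers outgrow [C]. This removes
    the multiplicative constant from a growth estimate, so that crude counts give a sharp bound. *)
Lemma le_of_expr_le (a b C : R) :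
  0 <= a -> 0 < b -> (forall j : nat, a ^+ j <= C * b ^+ j) -> a <= b.
Proof.
move=> a0 b0 abC; rewrite leNgt; apply/negP => ba.
have c0 : 0 < a / b - 1 by rewrite subr_gt0 ltr_pdivlMr// mul1r.
have bern j : 1 + j%:R * (a / b - 1) <= (a / b) ^+ j.
  elim: j => [|j IH]; first by rewrite mul0r addr0 expr0.
  have ab0 : 0 <= a / b by rewrite divr_ge0// ltW.
  rewrite exprS; apply: le_trans (ler_wpM2l ab0 IH).
  rewrite -natr1; set c := a / b in c0 *.
  have : 0 <= j%:R * ((c - 1) * (c - 1)) :> R by rewrite mulr_ge0// mulr_ge0// ltW.
  lra.
pose j := Num.bound (C / (a / b - 1)).
have := bern j; rewrite leNgt => /negP; apply.
apply: (@le_lt_trans _ _ C).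
  by rewrite expr_div_n ler_pdivrMr ?exprn_gt0.
apply: (@lt_le_trans _ _ (j%:R * (a / b - 1))); last by rewrite lerDr.
rewrite -ltr_pdivrMr//; apply: archi_boundP.
by rewrite divr_ge0 ?(ltW c0)//; have := abC 0%N; rewrite !expr0 mulr1; exact: le_trans.
Qed.

(* Distinct points fall into distinct cells of a grid of mesh [s]. *)
Lemma card_sup_separated (m : nat) (I : finType) (b : I -> 'I_m -> R) (Z s : R) :
  0 <= Z -> 0 < s -> (forall i l, `|b i l| <= Z) ->
  (forall i i', i != i' -> exists l, s <= `|b i l - b i' l|) ->
  #|I|%:R <= (2 * Z / s + 1) ^+ m.
Proof.
move=> Z0 s0 bZ bs.
pose Q := Num.truncn (2 * Z / s).
have Zs0 : 0 <= 2 * Z / s by rewrite divr_ge0 ?mulr_ge0// ltW.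
have bZs i l : 0 <= (b i l + Z) / s <= 2 * Z / s.
  have := bZ i l; rewrite ler_norml => /andP[lb ub].
  rewrite divr_ge0 ?(ltW s0)//=; last by lra.
  by rewrite ler_pM2r ?invr_gt0//; lra.
have cellP i l : (Num.truncn ((b i l + Z) / s) < Q.+1)%N.
  by rewrite ltnS le_truncn//; have /andP[] := bZs i l.
pose cell i := [ffun l : 'I_m => Ordinal (cellP i l)].
have cell_inj : injective cell.
  move=> i i' /ffunP cii'; apply/eqP; apply: contraT => /bs[l].
  rewrite leNgt; have := cii' l; rewrite !ffunE => /(congr1 val) /= tE.
  have /andP[/truncn_itv/andP[]+ + _] := bZs i l; rewrite tE.
  have /andP[/truncn_itv/andP[]+ + _] := bZs i' l.
  set q := Num.truncn _; rewrite -natr1.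
  rewrite !ler_pdivlMr// !ltr_pdivrMr// => h1 h2 h3 h4.
  by rewrite ltr_norml; move/negP; case; apply/andP; split; lra.
have := leq_card _ cell_inj; rewrite card_ffun !card_ord => le_card.
have : #|I|%:R <= (Q.+1 ^ m)%:R :> R by rewrite ler_nat.
move/le_trans; apply; rewrite natrX lerXn2r ?nnegrE ?addr_ge0//.
by rewrite -natr1 lerD2r truncn_le.
Qed.

Context {k : scalar_kind} {X : normedModType (scalar_field R k)}.

Lemma rnorm_real_comb (m : nat) (u : 'I_m -> X) (a : 'I_m -> R) (s : R) :
  (forall l, `|a l| <= s) ->
  rnorm (\sum_l of_real k (a l) *: u l) <= s * \sum_l rnorm (u l).
Proof.
move=> as_; apply: le_trans (rnorm_sum _) _.
rewrite mulr_sumr; apply: ler_sum => l _.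
by rewrite rnormZ ler_wpM2r ?rnorm_ge0.
Qed.

(* The points [a] tile themselves: the sums [\sum_(l < j) t ^+ l *: a i_l] over
   all words [i] of length [j] are still [rho]-separated, because the dilation
   factor [t] satisfies [2 * M = rho * (t - 1)].  There are [N ^ j] of them, and
   they have size [O(t ^+ j)]; a grid count then gives [N ^ j = O(t ^+ (m * j))],
   with no need to compute volumes. *)
Lemma packing_bound (m N : nat) (u : 'I_m -> X) (a : 'I_N -> 'I_m -> R) (M rho : R) :
  0 <= M -> 0 < rho ->
  (forall i, rnorm (\sum_l of_real k (a i l) *: u l) <= M) ->
  (forall i i', i != i' ->
     rho <= rnorm (\sum_l of_real k (a i l - a i' l) *: u l)) ->
  N%:R <= (1 + 2 * M / rho) ^+ m.
Proof.
move=> M0 rho0 aM asep.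
have t0 : 0 <= 2 * M / rho by rewrite divr_ge0 ?mulr_ge0// ltW.
(* For [M = 0] the dilation factor is 1 and the divisions by [t - 1] below lose their meaning;
   separation by [rho > 0] then leaves at most one point. *)
have [MM0|Mpos] := eqVneq M 0.
  have : (N <= 1)%N.
    rewrite leqNgt; apply/negP => N1.
    have := asep (Ordinal N1) (Ordinal (ltnW N1)) isT.
    under eq_bigr => l _ do rewrite rmorphB /= scalerBl.
    rewrite sumrB; have := rnormB (\sum_l of_real k (a (Ordinal N1) l) *: u l)
      (\sum_l of_real k (a (Ordinal (ltnW N1)) l) *: u l).
    have := aM (Ordinal N1); have := aM (Ordinal (ltnW N1)); lra.
  rewrite -(ler_nat R) => /le_trans; apply.
  by rewrite exprn_ege1// lerDl.
have Mgt0 : 0 < M by rewrite lt_def Mpos.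
have tgt0 : 0 < 2 * M / rho by rewrite divr_gt0// mulr_gt0.
set t := 1 + 2 * M / rho.
have tE : rho * (t - 1) = 2 * M by rewrite /t addrC addKr mulrCA divff ?mulr1// gt_eqF.
have t1 : 1 <= t by rewrite lerDl.
have tgt1 : 0 < t - 1 by rewrite /t addrC addKr.
pose A := \sum_i \sum_l `|a i l|.
have A0 : 0 <= A by rewrite sumr_ge0// => i _; rewrite sumr_ge0.
have aA i l : `|a i l| <= A.
  rewrite /A (bigD1 i)//= (bigD1 l)//= -addrA lerDl addr_ge0//.
    by rewrite sumr_ge0.
  by rewrite sumr_ge0// => j _; rewrite sumr_ge0.
(* Both size bounds are geometric sums: [M * (t ^+ j - 1) / (t - 1)] is [rho * (t ^+ j - 1) / 2] by
   the choice of [t], and the coordinates have [A] in place of [M]. *)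
have tiling j : exists (I : finType) (b : I -> 'I_m -> R), [/\ #|I| = (N ^ j)%N,
    forall i, rnorm (\sum_l of_real k (b i l) *: u l) <= rho * (t ^+ j - 1) / 2,
    forall i l, `|b i l| <= A / (t - 1) * (t ^+ j - 1) &
    forall i i', i != i' ->
      rho <= rnorm (\sum_l of_real k (b i l - b i' l) *: u l)].
  elim: j => [|j [I [b [cI bM bA bsep]]]].
    exists unit, (fun _ _ => 0); rewrite card_unit expr0 subrr !mulr0 mul0r.
    split=> // [_|_ l]; last by rewrite normr0.
    by rewrite big1 ?rnorm0// => l _; rewrite rmorph0 scale0r.
  have s0 : 0 <= t ^+ j by rewrite exprn_ge0// (le_trans _ t1).
  set s := t ^+ j in s0 bM bA *.
  exists (I * 'I_N)%type, (fun i l => b i.1 l + s * a i.2 l).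
  rewrite exprS -/s; split.
  - by rewrite card_prod cI card_ord expnSr.
  - move=> [i i2] /=; have -> : \sum_l of_real k (b i l + s * a i2 l) *: u l =
        \sum_l of_real k (b i l) *: u l + of_real k s *: \sum_l of_real k (a i2 l) *: u l.
      rewrite scaler_sumr -big_split; apply: eq_bigr => l _ /=.
      by rewrite rmorphD rmorphM /= scalerDl scalerA.
    apply: le_trans (rnormD _ _) _; rewrite rnormZ ger0_norm//.
    have := bM i; have := ler_wpM2l s0 (aM i2).
    have -> : s * M = rho * (t * s - s) / 2.
      by rewrite -(mulr1 s) mulrA -mulrBl !mulr1; nra.
    nra.
  - move=> [i i2] l /=; apply: le_trans (ler_normD _ _) _.
    rewrite normrM (ger0_norm s0).
    apply: le_trans (lerD (bA i l) (ler_wpM2l s0 (aA i2 l))) _.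
    by rewrite le_eqVlt; apply/orP; left; apply/eqP; field; rewrite gt_eqF.
  - move=> [i i2] [i' i2'] ne /=.
    have -> : \sum_l of_real k (b i l + s * a i2 l - (b i' l + s * a i2' l)) *: u l =
        of_real k s *: \sum_l of_real k (a i2 l - a i2' l) *: u l
        - (\sum_l of_real k (b i' l) *: u l - \sum_l of_real k (b i l) *: u l).
      rewrite scaler_sumr -!sumrB; apply: eq_bigr => l _ /=.
      rewrite scalerA -!scalerBl -!rmorphM -!rmorphB; congr (of_real k _ *: _); ring.
    (* Words with different last letters are at distance at least [rho * t ^+ j] minus twice the
       size bound, which is exactly [rho]. With equal last letters the dilated terms cancel and the
       induction hypothesis applies. *)
    have [i2E|i2i2'] := eqVneq i2 i2'; last first.
      set p := \sum_l of_real k (b i' l) *: u l; set p' := \sum_l of_real k (b i l) *: u l.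
      set w := of_real k s *: _.
      have := rnormB p p'; have := bM i; have := bM i'; rewrite -/p -/p'.
      have : s * rho <= rnorm w by rewrite rnormZ ger0_norm// ler_wpM2l// asep.
      have := rnormD (w - (p - p')) (p - p'); rewrite subrK; lra.
    rewrite i2E big1 ?scaler0 ?sub0r; last by move=> l _; rewrite subrr rmorph0 scale0r.
    rewrite opprB -sumrB; under eq_bigr => l _ do rewrite -scalerBl -rmorphB.
    by apply: bsep; apply: contraNneq ne => ->; rewrite i2E.
(* [U] strictly exceeds the sum of the norms of the [u l], so coordinates that all differ by less
   than [rho / U] give points closer than [rho]. Norm separation thus becomes coordinate
   separation. *)
pose U := 1 + \sum_l rnorm (u l).
have U0 : 0 < U.
  by rewrite ltr_pwDl// sumr_ge0// => l _; exact: rnorm_ge0.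
pose C := 2 * (A / (t - 1)) / (rho / U) + 1.
(* Since [t ^+ j >= 1], the additive 1 of the grid count is absorbed in [C * t ^+ j], whence
   [N ^ j <= C ^+ m * (t ^+ m) ^+ j] for every [j]. *)
apply: (@le_of_expr_le _ _ (C ^+ m)) => //; first by rewrite exprn_gt0// (lt_le_trans _ t1).
move=> j; have [I [b [cI _ bA bsep]]] := tiling j.
have At0 : 0 <= A / (t - 1) by rewrite divr_ge0// ltW.
have tj1 : 1 <= t ^+ j by rewrite exprn_ege1.
rewrite -natrX -cI.
apply: le_trans (@card_sup_separated m I b (A / (t - 1) * t ^+ j) (rho / U) _ _ _ _) _.
- by rewrite mulr_ge0// (le_trans _ tj1).
- by rewrite divr_gt0.
- by move=> i l; apply: le_trans (bA i l) _; rewrite ler_wpM2l// gerBl.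
- move=> i i' /bsep; apply: contraPP => /forallNP small.
  apply/negP; rewrite -ltNge.
  apply: (@le_lt_trans _ _ (rho / U * \sum_l rnorm (u l))).
    apply: rnorm_real_comb => l; apply: ltW; rewrite ltNge; apply/negP; exact: small.
  by rewrite mulrAC ltr_pdivrMr// ltr_pM2l// ltrDr.
have rU0 : 0 < rho / U by rewrite divr_gt0.
have C0 : 0 <= C by rewrite addr_ge0// divr_ge0 ?(ltW rU0)// mulr_ge0.
rewrite -exprM mulnC exprM -exprMn lerXn2r ?nnegrE//.
- rewrite addr_ge0// divr_ge0 ?(ltW rU0)// mulr_ge0// mulr_ge0//.
  exact: le_trans tj1.
- by rewrite mulr_ge0// (le_trans _ tj1).
- rewrite /C; set Y := A / (t - 1); set c := t ^+ j in tj1 *.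
  rewrite [leRHS]mulrDl mul1r (mulrA 2) (mulrAC (2 * Y)).
  by rewrite lerD2l.
Qed.

End packing.

(** * Finite covers and their images *)

Section covers.
Context {R : realType} {k : scalar_kind} {X : normedModType (scalar_field R k)}.
Implicit Types (G Y : set X) (s : seq X) (e : R).

Definition covers G e s :=
  (forall c, c \in s -> G c) /\
  forall y, G y -> exists2 c, c \in s & rnorm (c - y) < e.

Lemma covering_number_le G e s :
  covers G e s -> (covering_number G e <= (size s)%:R%:E)%E.
Proof.
move=> [sG Gs]; apply: ereal_inf_lbound; exists (size s) => //.
exists (tnth (in_tuple s)); split=> [i|y /Gs[c cs cy]].
  exact/sG/mem_tnth.
by have /(tnthP (in_tuple s))[i ci] := cs; exists i => //; rewrite /oball /= -ci.
Qed.

(** A separated list to which no point of [Y] can be added is already a net. If no such net existed,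
    separated lists could be extended to every length, contradicting the bound [H]. *)
Lemma maximal_separated Y e (H : R) : 0 < e ->
  (forall N (p : 'I_N -> X), (forall i, Y (p i)) ->
    (forall i i', i != i' -> e <= rnorm (p i - p i')) -> N%:R <= H) ->
  exists2 s, covers Y e s & (size s)%:R <= H.
Proof.
move=> e0 sepH.
pose sep s := (forall c, c \in s -> Y c) /\ pairwise (fun x y => e <= rnorm (x - y)) s.
have sep_size s : sep s -> (size s)%:R <= H.
  move=> [sY /(pairwiseP 0) ps].
  apply: (sepH _ (tnth (in_tuple s))) => [i|i i' ii']; first exact/sY/mem_tnth.
  rewrite !(tnth_nth 0) /=.
  have [ltii'|lti'i|/val_inj/eqP] := ltngtP i i'; last by rewrite (negbTE ii').
    by apply: ps; rewrite ?inE.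
  by rewrite rdistC; apply: ps; rewrite ?inE.
apply: contrapT => nocov.
have ext n : exists2 s, sep s & size s = n.
  elim: n => [|n [s [sY ps] sn]]; first by exists [::].
  have [c [Yc cs]] : exists c, Y c /\ forall x, x \in s -> e <= rnorm (c - x).
    apply: contrapT => none; apply: nocov; exists s; last exact: sep_size.
    split=> // y Yy; apply: contrapT => far; apply: none; exists y; split=> // x xs.
    by rewrite leNgt rdistC; apply/negP => xy; apply: far; exists x.
  exists (c :: s); last by rewrite /= sn.
  split; first by move=> x; rewrite inE => /predU1P[->|/sY].
  by rewrite /= ps andbT; apply/allP.
have [s seps sE] := ext (Num.bound H).
have H0 : 0 <= H by apply: le_trans (sep_size [::] _).
by have := sep_size _ seps; rewrite sE leNgt archi_boundP.
Qed.

(** A ball that misses the remaining part of [G] is dropped; a ball that meets it is replaced by the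
    ball of twice the radius around a common point. *)
Lemma recenter G e s :
  (forall y, G y -> exists2 c, c \in s & rnorm (c - y) < e) ->
  exists2 s', covers G (2 * e) s' & (size s' <= size s)%N.
Proof.
elim: s G => [|c s IH] G Gs.
  by exists [::] => //; split=> // y /Gs[].
have [|s' [s'G Gs'] size_s'] := IH (G `\` oball c e).
  move=> y [/Gs[x + xy]] cy; rewrite inE => /predU1P[xc|]; last by exists x.
  by case: cy; rewrite -xc.
have [[x [Gx cx]]|none] := pselect (exists x, G x /\ oball c e x).
  exists (x :: s'); last by rewrite /= ltnS.
  split=> [y|y Gy]; first by rewrite inE => /predU1P[->|/s'G[]].
  have [cy|cy] := pselect (oball c e y).
    exists x; first by rewrite mem_head.
    have := rdistD c x y; have := rdistC x c; move: cx cy; rewrite /oball /=; lra.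
  by have [x' x's' x'y] := Gs' _ (conj Gy cy); exists x'; rewrite // inE x's' orbT.
exists s'; last exact: leqW.
split=> [y /s'G[]//|y Gy]; apply: Gs'; split=> // cy.
by apply: none; exists y.
Qed.

(** The local hypothesis ranges over all subsets [G'] because the induction removes from [G] what
    the first ball covers, and a cover centered in a set need not have its centers in a smaller
    one. *)
Lemma covers_image (f : X -> X) G (r e H : R) s :
  (forall y, G y -> exists2 c, c \in s & rnorm (c - y) < r) ->
  (forall c G', c \in s -> G' `<=` G `&` oball c r ->
     exists2 s', covers (f @` G') e s' & (size s')%:R <= H) ->
  exists2 s', covers (f @` G) e s' & (size s')%:R <= H * (size s)%:R.
Proof.
elim: s G => [|c s IH] G Gs loc.
  exists [::]; last by rewrite mulr0.
  by split=> // z [y /Gs[]].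
have [| |s1 [s1G Gs1] size1] := IH (G `\` oball c r).
- move=> y [/Gs[x + xy]] cy; rewrite inE => /predU1P[xc|]; last by exists x.
  by case: cy; rewrite -xc.
- move=> x G' xs G'G; apply: (loc x); first by rewrite inE xs orbT.
  by move=> y /G'G[[Gy _] xy].
have [s2 [s2G Gs2] size2] := loc c _ (mem_head _ _) (@subset_refl _ (G `&` oball c r)).
exists (s2 ++ s1); last by rewrite size_cat natrD /= -natr1 mulrDr mulr1 addrC lerD.
split=> [y|_ [y Gy <-]].
  rewrite mem_cat => /orP[/s2G|/s1G] [x [Gx _] <-]; by exists x.
have [cy|cy] := pselect (oball c r y).
  have [|x xs xy] := Gs2 (f y); first by exists y.
  by exists x; rewrite // mem_cat xs.
have [|x xs xy] := Gs1 (f y); first by exists y.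
by exists x; rewrite // mem_cat xs orbT.
Qed.

(** Over the complex numbers [u] lists the [v i] followed by their multiples by the imaginary unit.
    This is where the exponent doubles. *)
Lemma real_coordinates (n m : nat) (v : 'I_n -> X) : m = (real_dim k * n)%N ->
  exists u : 'I_m -> X, forall a : 'I_n -> scalar_field R k,
    exists a' : 'I_m -> R,
      \sum_i a i *: v i = \sum_l of_real k (a' l) *: u l.
Proof.
case: k X v => /= Y v mE.
  have {mE}mE : m = n by rewrite mE mul1n.
  by subst m; exists v => a; exists a.
have {mE}mE : m = (n + n)%N by rewrite mE mul2n addnn.
subst m; exists (fun l => match fintype.split l with
  | inl i => v i | inr i => ('i%C : R[i]) *: v i end) => a.
exists (fun l => match fintype.split l with
  | inl i => complex.Re (a i) | inr i => complex.Im (a i) end).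
rewrite big_split_ord /= -big_split /=; apply: eq_bigr => i _.
have := unsplitK (inl i : 'I_n + 'I_n); have := unsplitK (inr i : 'I_n + 'I_n).
rewrite /unsplit => -> ->.
by rewrite scalerA -scalerDl; congr (_ *: _); case: (a i) => p q; simpc.
Qed.

(** Images of points of [F] are real combinations of [real_dim k * n] fixed vectors, so
    [packing_bound] limits an [e]-separated set of them, and a maximal one is a net. *)
Lemma subspace_image_cover (L : {linear X -> X}) (F : set X) (n : nat) (M e : R) :
  subspace_of_dim F n -> 0 <= M -> 0 < e ->
  (forall z, rnorm z <= 1 -> rnorm (L z) <= M) ->
  exists2 s : seq X, (size s)%:R <= (1 + 2 * M / e) ^+ (real_dim k * n) &
    forall z, F z -> rnorm z <= 1 -> exists2 c, c \in s & rnorm (c - L z) < e.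
Proof.
move=> [v [_ FE]] M0 e0 LM.
have [u uP] := real_coordinates (fun i => L (v i)) (erefl (real_dim k * n)%N).
pose Y := [set L z | z in [set z | F z /\ rnorm z <= 1]].
have [|s [_ Ys] sH] := @maximal_separated Y e ((1 + 2 * M / e) ^+ (real_dim k * n)) e0.
  move=> N p Yp psep.
  have coord i : exists a : 'I_(real_dim k * n) -> R,
      p i = \sum_l of_real k (a l) *: u l.
    have [z [+ _] <-] := Yp i; rewrite FE => -[b _ <-].
    rewrite linear_sum; under eq_bigr do rewrite linearZ /=.
    exact: uP.
  have [a pa] := choice coord.
  apply: (packing_bound (u := u) (a := a)) => // [i|i i' ii'].
    by rewrite -pa; have [z [_ z1] <-] := Yp i; exact: LM.
  under eq_bigr do rewrite rmorphB scalerBl.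
  by rewrite sumrB -!pa psep.
exists s => // z Fz z1; apply: Ys; by exists z.
Qed.

End covers.

(** * Operator norms, derivatives and the mean value inequality *)

Section operators.
Context {R : realType} {k : scalar_kind} {X : normedModType (scalar_field R k)}.

Lemma opnorm_leP (f : X -> X) (c : R) :
  (opnorm f <= c%:E)%E <-> forall w, rnorm w <= 1 -> rnorm (f w) <= c.
Proof.
split=> [fc w w1|fc].
  by rewrite -lee_fin; apply: le_trans fc; apply: ereal_sup_ubound; exists w.
by apply: ge_ereal_sup => _ [w w1 <-]; rewrite lee_fin fc.
Qed.

(** Only homogeneity under real scalars is assumed, so that the lemma applies to a difference of two
    derivatives written as a bare function. *)
Lemma opnorm_rnorm (f : X -> X) (c : R) :
  (forall s w, f (of_real k s *: w) = of_real k s *: f w) ->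
  (opnorm f <= c%:E)%E -> forall w, rnorm (f w) <= c * rnorm w.
Proof.
move=> fZ /opnorm_leP fc w.
have [w0|w0] := eqVneq (rnorm w) 0.
  have -> : w = 0.
    by apply/normr0_eq0; rewrite -of_real_rnorm w0 rmorph0.
  have := fZ 0 0; rewrite !rmorph0 !scale0r => ->.
  by rewrite rnorm0 mulr0.
have wgt0 : 0 < rnorm w by rewrite lt_def w0 rnorm_ge0.
have := fc (of_real k (rnorm w)^-1 *: w).
rewrite fZ !rnormZ ger0_norm ?invr_ge0 ?rnorm_ge0// mulVf// => /(_ (lexx _)).
by rewrite mulrC ler_pdivrMr.
Qed.

Lemma opnorm_continuous (f : {linear X -> X}) :
  continuous f -> exists2 c, 0 <= c & (opnorm f <= c%:E)%E.
Proof.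
move=> /(_ 0) f0.
have /f0 /rnorm_nbhsP[e e0 eP] : nbhs (f 0) (oball (f 0) 1).
  by apply/rnorm_nbhsP; exists 1.
have fZ s w : f (of_real k s *: w) = of_real k s *: f w by rewrite linearZ.
(* The dilation by [e / 2] carries the unit ball into the ball on which [f] has norm below 1. *)
exists (2 / e); first by rewrite divr_ge0// ltW.
apply/opnorm_leP => w w1.
have := eP (of_real k (e / 2) *: w).
rewrite /oball /= linear0 !sub0r !rnormN fZ !rnormZ ger0_norm; last first.
  by rewrite divr_ge0// ltW.
have -> : (e / 2 * rnorm w < e) by nra.
move=> /(_ isT) h; rewrite ler_pdivlMr//; nra.
Qed.

Lemma differentiable_rnorm (f : X -> X) (y : X) (e : R) :
  differentiable f y -> 0 < e -> exists2 d, 0 < d &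
    forall h, rnorm h < d -> rnorm (f (y + h) - f y - 'd f y h) <= e * rnorm h.
Proof.
move=> /diff_locallyP[_ /eqaddoP fy] e0.
have e0' : 0 < of_real k e by rewrite -(rmorph0 (of_real k)) of_real_lt.
have /rnorm_nbhsP[d d0 dP] := fy _ e0'.
exists d => // h hd; rewrite -(of_real_le k) rmorphM /= !of_real_rnorm.
have := dP h; rewrite sub0r rnormN => /(_ hd) /=.
have -> : f (y + h) - f y - 'd f y h = (f \o +%R^~ y - (cst (f y) + 'd f y)) h.
  by rewrite -addrA -opprD addrC [y + h]addrC [RHS]addrC.
by [].
Qed.

(** Continuous induction: let [a] be the supremum of the [s] such that the bound [c * u] holds on
    the whole of [[0, s]]. The local estimate at [a] carries the bound from the left to [a] itself,
    and past [a] if [a < 1]. *)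
Lemma mean_value_interval (g : R -> X) (c : R) :
  (forall a, 0 <= a <= 1 -> exists2 d, 0 < d & forall u, 0 <= u <= 1 ->
     `|u - a| < d -> rnorm (g u - g a) <= c * `|u - a|) ->
  rnorm (g 1 - g 0) <= c.
Proof.
move=> gloc.
pose ok u := rnorm (g u - g 0) <= c * u.
pose E := [set s | 0 <= s <= 1 /\ forall u, 0 <= u <= s -> ok u].
have E0 : E 0.
  split=> [|u]; first by rewrite lexx ler01.
  by move=> /le_anti <-; rewrite /ok subrr rnorm0 mulr0.
have ubE : ubound E 1 by move=> s [/andP[]].
have supE : has_sup E by split; [exists 0|exists 1].
set a := sup E.
have a0 : 0 <= a by apply: ub_le_sup => //; exists 1.
have a1 : a <= 1 by apply: ge_sup => //; exists 0.
have ok_lt u : 0 <= u -> u < a -> ok u.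
  move=> u0 ua; have e0 : 0 < a - u by rewrite subr_gt0.
  have [s [_ Es]] := sup_adherent e0 supE.
  by rewrite -/a opprB addrC subrK => /ltW us; apply: Es; rewrite u0.
have [|d d0 gd] := gloc a; first by rewrite a0.
have ok_a : ok a.
  have [->|an0] := eqVneq a 0; first by rewrite /ok subrr rnorm0 mulr0.
  have agt0 : 0 < a by rewrite lt_def an0.
  pose s := Num.max (a / 2) (a - d / 2).
  have sa : s < a by rewrite gt_max; apply/andP; split; lra.
  have s0 : 0 <= s by rewrite le_max; apply/orP; left; lra.
  have sd : a - d < s by rewrite lt_max; apply/orP; right; lra.
  have oks := ok_lt _ s0 sa.
  have := gd s; rewrite ltr0_norm ?subr_lt0// opprB.
  rewrite s0 (ltW (lt_le_trans sa a1)) => /(_ isT) gs.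
  have {}gs := gs ltac:(lra).
  rewrite /ok in oks *; have := rdistD (g s) (g a) (g 0).
  rewrite rdistC in gs; lra.
have ok_gt u : a <= u -> u <= 1 -> u < a + d -> ok u.
  move=> au u1 ud; have := gd u; rewrite ger0_norm ?subr_ge0// u1 (le_trans a0 au).
  move=> /(_ isT) gu; have {}gu := gu ltac:(lra).
  rewrite /ok in ok_a *; have := rdistD (g a) (g u) (g 0); lra.
suff a1E : a = 1 by move: ok_a; rewrite a1E /ok mulr1.
apply/eqP; rewrite eq_le a1 leNgt; apply/negP => alt1.
pose v := Num.min 1 (a + d / 2).
have av : a < v by rewrite lt_min alt1; lra.
have v1 : v <= 1 by rewrite ge_min lexx.
have vd : v < a + d by rewrite gt_min; apply/orP; right; lra.
have : v <= a.
  apply: ub_le_sup; first by exists 1.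
  split=> [|u /andP[u0 uv]]; first by rewrite v1 (le_trans a0 (ltW av)).
  have [ua|au] := ltP u a; first exact: ok_lt.
  by apply: ok_gt => //; [exact: le_trans v1|exact: le_lt_trans vd].
by rewrite leNgt av.
Qed.

(** Along the segment, [f - D] has local slope at most [2 * c * rnorm v]: one [c] bounds the error
    of differentiation at [z], the other the distance from ['d f z] to [D]. *)
Lemma mean_value (f : X -> X) (D : {linear X -> X}) (x v : X) (c : R) : 0 < c ->
  (forall s, 0 <= s <= 1 -> let z := x + of_real k s *: v in
     differentiable f z /\ forall w, rnorm ('d f z w - D w) <= c * rnorm w) ->
  rnorm (f (x + v) - f x - D v) <= 2 * c * rnorm v.
Proof.
move=> c0 fD.
pose g s := f (x + of_real k s *: v) - D (of_real k s *: v).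
have -> : f (x + v) - f x - D v = g 1 - g 0.
  rewrite /g rmorph1 rmorph0 scale1r scale0r addr0 linear0 subr0.
  by rewrite addrAC.
apply: mean_value_interval => a a01.
have [dfz Dz] := fD a a01; set z := x + of_real k a *: v in dfz Dz.
have [d d0 dP] := differentiable_rnorm dfz c0.
have v1 : 0 < rnorm v + 1 by rewrite ltr_wpDl ?rnorm_ge0.
(* The added 1 keeps the quotient meaningful when [v = 0]. *)
exists (d / (rnorm v + 1)); first by rewrite divr_gt0.
move=> u u01; rewrite ltr_pdivlMr// => ua.
set h := of_real k (u - a) *: v.
have hE : rnorm h = `|u - a| * rnorm v by rewrite rnormZ.
have hd : rnorm h < d.
  by rewrite hE; have := normr_ge0 (u - a); nra.
have uE : x + of_real k u *: v = z + h.
  by rewrite /z /h -addrA; congr (_ + _); rewrite rmorphB /= scalerBl addrC subrK.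
have -> : g u - g a = (f (z + h) - f z - 'd f z h) + ('d f z h - D h).
  have Dh : D h = D (of_real k u *: v) - D (of_real k a *: v).
    by rewrite -linearB /= -scalerBl -rmorphB.
  by rewrite /g uE -/z [RHS]addrA subrK Dh !opprD addrACA.
have := rnormD (f (z + h) - f z - 'd f z h) ('d f z h - D h).
have := dP h hd; have := Dz h; rewrite hE; lra.
Qed.

Lemma compact_finite_cover (A : set X) (d : X -> R) : compact A ->
  (forall a, A a -> 0 < d a) ->
  exists s : seq X, (forall c, c \in s -> A c) /\
    forall y, A y -> exists2 c, c \in s & rnorm (c - y) < d c.
Proof.
rewrite compact_cover => Aco d0.
have [||D DA AD] := Aco X A (fun a => oball a (d a)).
- by move=> a _; exact: open_oball.
- by move=> a Aa; exists a => //; rewrite /oball /= subrr rnorm0 d0.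
exists (finmap.enum_fset D); split=> [c cD|y /AD[c cD cy]]; last by exists c.
by have := DA c cD; rewrite inE.
Qed.

End operators.

(** * Approximation of an operator on a finite-dimensional subspace *)

Section nu.
Context {R : realType} {k : scalar_kind}.

Lemma ex_min_nat (P : set nat) : P !=set0 ->
  exists2 m, P m & forall p, P p -> (m <= p)%N.
Proof.
move=> [m0 Pm0].
have exP : exists m, `[< P m >] by exists m0; apply/asboolP.
have [m /asboolP Pm mmin] := ex_minnP exP.
by exists m => // p Pp; apply: mmin; apply/asboolP.
Qed.

Context {X : normedModType (scalar_field R k)}.
Implicit Types (L : X -> X) (F : set X) (m : nat) (l : R).

(** The condition inside [nu] without suprema and infima: the constant [c] records the strict
    inequality uniformly in [w], and its gap to [2 * l] is the room for perturbing [L]. *)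
Definition approximable l L m := exists2 F, subspace_of_dim F m &
  exists2 c, c < 2 * l & forall w, rnorm w <= 1 ->
    exists z, [/\ F z, rnorm z <= 1 & rnorm (L (w - z)) <= c].

Lemma nu_approximable l L : nu l L = least R (approximable l L).
Proof.
congr (least R _); apply/seteqP; split=> m [F Fm] /=.
  set s := ereal_sup _ => sl; exists F => //.
  (* With [c] strictly above the supremum, each infimum is below [c] and is undercut by an actual
     point [z]. If the supremum is [-oo], any real below [2 * l] serves. *)
  have [c sc cl] : exists2 c : R, (s < c%:E)%E & c < 2 * l.
    case: s sl => [s|//|_]; last by exists (2 * l - 1); rewrite ?ltNyr//; lra.
    by rewrite lte_fin => sl; exists ((s + 2 * l) / 2); rewrite ?lte_fin; lra.
  exists c => // w w1.
  have : (ereal_inf [set (rnorm (L (w - z)))%:E | z in [set z | F z /\ (rnorm z <= 1)%R]]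
      < c%:E)%E.
    by apply: le_lt_trans sc; apply: ereal_sup_ubound; exists w.
  move=> /ereal_inf_lt[_ [z [Fz z1] <-]]; rewrite lte_fin => /ltW zc.
  by exists z.
move=> [c cl Fc]; exists F => //.
apply: (@le_lt_trans _ _ c%:E); last by rewrite lte_fin.
apply: ge_ereal_sup => _ [w w1 <-].
have [z [Fz z1 zc]] := Fc w w1.
apply: (@le_trans _ _ (rnorm (L (w - z)))%:E); last by rewrite lee_fin.
by apply: ereal_inf_lbound; exists z.
Qed.

(** The same subspace serves: [w - z] has norm at most 2, so the change of operator costs at most
    [2 * e], which is half the gap between [c] and [2 * l]. *)
Lemma approximable_near l L m : approximable l L m ->
  exists2 e, 0 < e & forall L' : X -> X,
    (forall w, rnorm (L' w - L w) <= e * rnorm w) -> approximable l L' m.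
Proof.
move=> [F Fm [c cl Fc]]; exists ((2 * l - c) / 4); first by lra.
move=> L' LL'; exists F => //; exists ((2 * l + c) / 2); first by lra.
move=> w w1; have [z [Fz z1 zc]] := Fc w w1; exists z; split => //.
have := rnormD (L' (w - z) - L (w - z)) (L (w - z)); rewrite subrK.
have := LL' (w - z); have := rnormB w z; nra.
Qed.

(** A spanning family of least length is independent, since a nontrivial relation would allow one of
    its vectors to be eliminated. *)
Lemma subspace_of_dim_span (n : nat) (e : 'I_n -> X) :
  exists m (F : set X), subspace_of_dim F m /\ forall i, F (e i).
Proof.
pose spanned m := exists b : 'I_m -> X, forall i, exists a : 'I_m -> scalar_field R k,
  \sum_j a j *: b j = e i.
have [m [b be] mmin] : exists2 m, spanned m & forall p, spanned p -> (m <= p)%N.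
  apply: ex_min_nat; exists n, e => i; exists (fun j => (j == i)%:R).
  rewrite (bigD1 i)//= eqxx scale1r big1 ?addr0// => j /negPf ->.
  by rewrite scale0r.
exists m, [set \sum_j a j *: b j | a in [set: 'I_m -> scalar_field R k]].
split; last by move=> i; have [a ae] := be i; exists a.
exists b; split=> // a a0 j0; apply/eqP; apply: contraT => aj0.
case: m b be mmin a a0 j0 aj0 => [|m] b be mmin a a0 j0 aj0; first by case: j0 aj0.
suff /mmin : spanned m by rewrite ltnn.
exists (fun j => b (lift j0 j)) => i; have [c ce] := be i.
(* Subtracting this multiple of the relation makes the coefficient at [j0] vanish. *)
exists (fun j => c (lift j0 j) - c j0 / a j0 * a (lift j0 j)).
have <- : \sum_j (c j - c j0 / a j0 * a j) *: b j = e i.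
  under eq_bigr do rewrite scalerBl -scalerA.
  by rewrite sumrB -scaler_sumr a0 scaler0 subr0.
by rewrite (bigD1_ord j0)//= divfK// subrr scale0r add0r.
Qed.

(* The span of finitely many points whose images under [K] form a net of the
   image of the unit ball. *)
Lemma compact_perturbation_approximable l (L : X -> X) (K C : {linear X -> X}) :
  compact_operator K -> (opnorm C < l%:E)%E -> (forall w, L w = K w + C w) ->
  exists m, approximable l L m.
Proof.
move=> Kco Cl LE.
have [c cl Cc] : exists2 c, c < l & (opnorm C <= c%:E)%E.
  case: (opnorm C) Cl => [c|//|_]; first by exists c => //; rewrite lte_fin in Cl.
  by exists (l - 1); rewrite ?leNye//; lra.
have c0 : 0 <= c.
  by move/opnorm_leP: Cc => /(_ 0); rewrite linear0 rnorm0; apply.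
have {}Cc : forall w, rnorm (C w) <= c * rnorm w.
  by apply: opnorm_rnorm Cc => s w; rewrite linearZ.
pose G := [set w : X | rnorm w <= 1].
have Gb : bounded_set G by apply/rnorm_bounded_setP; exists 1.
have := Kco _ Gb; rewrite precompactE => clK.
pose e := (l - c) / 2; have e0 : 0 < e by rewrite /e; lra.
have [s [sK Ks]] := compact_finite_cover clK (fun _ _ => e0).
(* The net lies only in the closure of the image, so each of its points is moved by less than [e] to
   the image of a point of the unit ball. *)
have near_pt y : exists w, y \in s -> rnorm w <= 1 /\ rnorm (y - K w) < e.
  have [ys|_] := boolP (y \in s); last by exists 0.
  have /rnorm_nbhsP : nbhs y (oball y e).
    by apply/rnorm_nbhsP; exists e.
  move=> /rnorm_nbhsP /(sK y ys)[_ [[w Gw <-] yw]].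
  by exists w.
have [p pP] := choice near_pt.
have [m [F [Fm Fp]]] := subspace_of_dim_span (fun i => p (tnth (in_tuple s) i)).
(* [K] contributes [2 * e = l - c] and [C] at most [2 * c], because [w - z] has norm at most 2; the
   total [l + c] is below [2 * l]. *)
exists m, F => //; exists (2 * e + 2 * c); first by rewrite /e; lra.
move=> w w1.
have [|y ys yw] := Ks (K w); first by apply: subset_closure; exists w.
have [py1 ypy] := pP y ys.
have /(tnthP (in_tuple s))[i yi] := ys.
exists (p y); split => //; first by rewrite yi.
rewrite LE; apply: le_trans (rnormD _ _) _.
have := Cc (w - p y); have := rnormB w (p y).
have := rdistD y (K w) (K (p y)); rewrite -linearB (rdistC _ y).
have := ler_wpM2l c0 (rnormB w (p y)); nra.
Qed.

End nu.

(** * One step of the covering estimate and uniformity near the attractor *)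

Section dynamics.
Context {R : realType} {k : scalar_kind} {X : normedModType (scalar_field R k)}.
Implicit Types (f : X -> X) (A G : set X) (s : seq X).

Lemma local_contraction f (D : {linear X -> X}) (x : X) G (r sigma lambda M : R) (n : nat) :
  0 < r -> 0 < sigma -> 0 <= M -> (opnorm D <= M%:E)%E ->
  approximable lambda D n ->
  (forall v, rnorm v < r -> rnorm (f (x + v) - f x - D v) <= sigma / 4 * rnorm v) ->
  G `<=` oball x r ->
  exists2 s, covers (f @` G) ((sigma + 4 * lambda) * r) s &
    (size s)%:R <= (1 + 8 * M / sigma) ^+ (real_dim k * n).
Proof.
move=> r0 sigma0 M0 /opnorm_leP DM [F Fn [c c2l Fc]] fD Gr.
have e0 : 0 < sigma / 4 by rewrite divr_gt0.
have [s sM Fs] := subspace_image_cover Fn M0 e0 DM.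
(* In units of [r], the net of the image of the subspace and the linearization each cost
   [sigma / 4], and the approximation by the subspace costs less than [2 * lambda]. *)
have [|s' s'G ss'] := @recenter _ _ _ (f @` G) ((sigma / 2 + 2 * lambda) * r)
  [seq f x + of_real k r *: p | p <- s].
  move=> _ [y Gy <-]; set v := y - x.
  have vr : rnorm v < r by rewrite rdistC; exact: Gr.
  set w := of_real k r^-1 *: v.
  have vE : v = of_real k r *: w.
    by rewrite scalerA -rmorphM mulfV ?gt_eqF// rmorph1 scale1r.
  have w1 : rnorm w <= 1.
    by rewrite rnormZ ger0_norm ?invr_ge0 ?ltW// mulrC ltr_pdivrMr// mul1r.
  have [z [Fz z1 zc]] := Fc w w1; have [p ps pz] := Fs z Fz z1.
  exists (f x + of_real k r *: p); first exact: map_f.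
  have -> : f x + of_real k r *: p - f y = of_real k r *: (p - D z)
      - of_real k r *: D (w - z) - (f (x + v) - f x - D v).
    have -> : x + v = y by rewrite addrC subrK.
    have -> : D v = of_real k r *: D w by rewrite [in LHS]vE linearZ.
    have -> : of_real k r *: (p - D z) - of_real k r *: D (w - z) =
        of_real k r *: p - of_real k r *: D w.
      by rewrite (linearB D) !scalerBr opprB addrA subrK.
    by rewrite opprB [RHS]addrA subrK opprB [RHS]addrA (addrC (f x)).
  have := rnormB (of_real k r *: (p - D z) - of_real k r *: D (w - z))
    (f (x + v) - f x - D v).
  have := rnormB (of_real k r *: (p - D z)) (of_real k r *: D (w - z)).
  rewrite !rnormZ (ger0_norm (ltW r0)).
  have := fD v vr; nra.
exists s'.
  by rewrite (_ : _ * r = 2 * ((sigma / 2 + 2 * lambda) * r))//; field.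
have -> : 8 * M / sigma = 2 * M / (sigma / 4) by field; rewrite gt_eqF.
by apply: le_trans sM; rewrite ler_nat; move: ss'; rewrite size_map.
Qed.

(** A Lebesgue number argument: balls of radius [d c / 2] cover [A], and [3 * e <= d c / 2] leaves
    room for the step of [e] from [A] to [x] and of [2 * e] from [x] to [y]. *)
Lemma uniform_neighborhood A (d : X -> R) : compact A -> (forall a, A a -> 0 < d a) ->
  exists2 e, 0 < e & exists2 s : seq X, (forall c, c \in s -> A c) &
    forall x, oneighborhood A e x ->
      exists2 c, c \in s & forall y, rnorm (x - y) < 2 * e -> rnorm (c - y) < d c.
Proof.
move=> Aco d0.
have d20 a : A a -> 0 < d a / 2 by move/d0 => ?; rewrite divr_gt0.
have [s [sA As]] := compact_finite_cover Aco d20.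
have [e e0 es] : exists2 e, 0 < e & forall c, c \in s -> e <= d c / 6.
  elim: s sA {As} => [|c s IH] sA; first by exists 1.
  have [|e e0 es] := IH; first by move=> a as_; apply: sA; rewrite inE as_ orbT.
  have dc0 : 0 < d c by apply/d0/sA; exact: mem_head.
  exists (Num.min e (d c / 6)); first by rewrite lt_min e0 divr_gt0.
  move=> a; rewrite inE => /predU1P[->|/es ea]; first by rewrite ge_min lexx orbT.
  by rewrite ge_min ea.
exists e => //; exists s => // x [a Aa ax].
have [c cs ca] := As a Aa; exists c => // y xy.
have := es c cs; have := rdistD a c y; have := rdistD x a y.
move: ax ca xy; rewrite /oball /=; lra.
Qed.

Lemma seq_bounded (g : X -> R) s : exists b, forall c, c \in s -> g c <= b.
Proof.
elim: s => [|c s [b bs]]; first by exists 0.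
exists (Num.max (g c) b) => x; rewrite inE => /predU1P[->|/bs xb].
  by rewrite le_max lexx.
by rewrite le_max xb orbT.
Qed.

(** By continuity of the derivative, ['d f x] stays within [e2] of ['d f a]; taking [e2] below both
    [e] and the tolerance of [approximable_near] transfers every bound from [a] to [x]. *)
Lemma C1_local_bounds A f (a : X) (delta lambda e : R) :
  0 < delta -> 0 < e -> A a -> C1_on (oneighborhood A delta) f ->
  (exists m, approximable lambda ('d f a) m) ->
  exists (d : R) (m : nat) (M : R), 0 < d /\ forall x, rnorm (a - x) < d ->
    [/\ oneighborhood A delta x, (opnorm ('d f x) <= M%:E)%E,
        approximable lambda ('d f x) m &
        forall w, rnorm ('d f x w - 'd f a w) <= e * rnorm w].
Proof.
move=> delta0 e0 Aa fC1 [m am].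
have aU : oneighborhood A delta a.
  by exists a => //; rewrite /oball /= subrr rnorm0.
have [fa fcont] := fC1 a aU.
have [M M0 faM] := opnorm_continuous (diff_continuous fa).
have [e1 e10 e1m] := approximable_near am.
pose e2 := Num.min e e1; have e20 : 0 < e2 by rewrite lt_min e0.
have : nbhs (0%E : \bar R) [set y | (y < e2%:E)%E].
  apply: open_nbhs_nbhs; split; first exact: open_ereal_lt_ereal.
  by rewrite /= lte_fin.
move=> /fcont/rnorm_nbhsP[d1 d10 d1P].
exists (Num.min d1 delta), m, (e2 + M); split; first by rewrite lt_min d10.
move=> x; rewrite lt_min => /andP[/d1P /= /ltW xe2 xdelta].
have close w : rnorm ('d f x w - 'd f a w) <= e2 * rnorm w.
  move: w; apply: (@opnorm_rnorm _ _ _ (fun w => 'd f x w - 'd f a w)) => // t w.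
  by rewrite (linearZ_LR ('d f x)) (linearZ_LR ('d f a)) scalerBr.
have le_e2 t w : e2 <= t -> e2 * rnorm w <= t * rnorm w.
  by move=> e2t; rewrite ler_wpM2r ?rnorm_ge0.
split.
- by exists a.
- apply/opnorm_leP => w w1; move/opnorm_leP: faM => /(_ w w1).
  have := rnormD ('d f x w - 'd f a w) ('d f a w); rewrite subrK.
  have := close w; nra.
- apply: e1m => w; apply: le_trans (close w) _.
  by apply: le_e2; rewrite ge_min lexx orbT.
- by move=> w; apply: le_trans (close w) _; apply: le_e2; rewrite ge_min lexx.
Qed.

(** [n] is the least uniform bound. If it is positive, its minimality yields a point of [B] where no
    smaller dimension suffices, and the supremum is reached there. *)
Lemma ereal_sup_nu (B : set X) (l : R) (L : X -> X -> X) (n0 : nat) :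
  B !=set0 ->
  (forall y, B y -> exists2 m, (m <= n0)%N & approximable l (L y) m) ->
  exists2 n : nat, ereal_sup [set nu l (L y) | y in B] = n%:R%:E &
    forall y, B y -> exists2 m, (m <= n)%N & approximable l (L y) m.
Proof.
move=> [y0 By0] Bn0.
have [|n Bn nmin] := @ex_min_nat
  [set p | forall y, B y -> exists2 m, (m <= p)%N & approximable l (L y) m].
  by exists n0.
exists n => //; apply/eqP; rewrite eq_le; apply/andP; split.
  apply: ge_ereal_sup => _ [y By <-]; have [m mn am] := Bn y By.
  rewrite nu_approximable; apply: (@le_trans _ _ m%:R%:E); last by rewrite lee_fin ler_nat.
  by apply: ereal_inf_lbound; exists m.
case: n => [|n] in Bn nmin *.
  apply: (@le_trans _ _ (nu l (L y0))); last by apply: ereal_sup_ubound; exists y0.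
  by apply: le_ereal_inf_tmp => _ [m _ <-]; rewrite lee_fin.
have [y [By yn]] : exists y, B y /\ forall m, approximable l (L y) m -> (n < m)%N.
  apply: contrapT => none; suff /nmin : forall y, B y ->
    exists2 m, (m <= n)%N & approximable l (L y) m by rewrite ltnn.
  move=> y By; apply: contrapT => yn; apply: none; exists y; split=> // m am.
  by rewrite ltnNge; apply/negP => mn; apply: yn; exists m.
apply: (@le_trans _ _ (nu l (L y))); last by apply: ereal_sup_ubound; exists y.
rewrite nu_approximable; apply: le_ereal_inf_tmp => _ [m am <-].
by rewrite lee_fin ler_nat yn.
Qed.

Lemma ereal_sup_opnorm (B : set X) (L : X -> X -> X) (M0 : R) :
  B !=set0 -> (forall y, B y -> (opnorm (L y) <= M0%:E)%E) ->
  exists2 M : R, 0 <= M & ereal_sup [set opnorm (L y) | y in B] = M%:E.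
Proof.
move=> [y By] BM0.
set s := ereal_sup _.
have sM0 : (s <= M0%:E)%E by apply: ge_ereal_sup => _ [x Bx <-]; exact: BM0.
have s0 : (0 <= s)%E.
  apply: (@le_trans _ _ (opnorm (L y))); last by apply: ereal_sup_ubound; exists y.
  apply: (@le_trans _ _ (rnorm (L y 0))%:E); first by rewrite lee_fin rnorm_ge0.
  by apply: ereal_sup_ubound; exists 0 => //=; rewrite rnorm0.
by case: s sM0 s0 => [M _|//|//]; exists M.
Qed.

Lemma time_set_muln (J : set R) (T : R) (j : nat) :
  time_set J -> J T -> 0 < T -> J (j%:R * T).
Proof.
move=> [->|->] /=; first by move=> _ T0; rewrite mulr_ge0// ltW.
by move=> [n _ <-] _; exists (j * n)%N => //; rewrite natrM.
Qed.

Lemma time_setD (J : set R) (t u : R) : time_set J -> J t -> J u -> J (t + u).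
Proof.
move=> [->|->] /=; first exact: addr_ge0.
by move=> [a _ <-] [b _ <-]; exists (a + b)%N => //; rewrite natrD.
Qed.

End dynamics.

(** * The absorbing set and the iterated covering estimate *)

Theorem theorem8p3 (R : realType) (k : scalar_kind)
  (X : normedModType (scalar_field R k))
  (J : set R) (S : R -> X -> X) (A : set X) (T delta0 lambda : R)
  (hJ : time_set J) (hS : semigroup J S) (hA : global_attractor J S A)
  (hTJ : J T) (hT : 0 < T) (hdelta0 : 0 < delta0)
  (hC1 : C1_on (oneighborhood A delta0) (S T))
  (hlambda : 0 < lambda < 1 / 4)
  (hdec : forall y, oneighborhood A delta0 y ->
     exists K C : {linear X -> X},
       [/\ continuous K, compact_operator K, continuous C,
           (opnorm C < lambda%:E)%E &
           forall w, 'd (S T) y w = K w + C w])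
  (sigma : R) (hsigma : 0 < sigma < 1 - 4 * lambda) :
  let q := sigma + 4 * lambda in
  0 < q < 1 /\
  exists (r0 b0 h : R) (B : set X),
    [/\ 0 < r0, 0 < b0 & 1 <= h] /\
    [/\ bounded_set B, absorbing J S B, B `<=` oneighborhood A delta0,
        S T @` B `<=` B &
        forall j : nat, (0 < j)%N ->
          (covering_number (S (j%:R * T)%R @` B) (q ^+ j * r0)%R
             <= (b0 * h ^+ j)%:E)%E] /\
    exists (n : nat) (M : R),
      [/\ ereal_sup [set nu lambda ('d (S T) y) | y in B] = n%:R%:E,
          0 <= M,
          ereal_sup [set opnorm ('d (S T) y) | y in B] = M%:E &
          h <= (1 + 8 * Num.sqrt n%:R * M / sigma) ^+ (real_dim k * n)].
Proof.
move=> q; have q01 : 0 < q < 1 by rewrite /q; lra.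
split=> //.
have [sigma0 lambda0] : 0 < sigma /\ 0 < lambda by lra.
have [q0 q1] : 0 < q /\ q < 1 by lra.
have [A0 Aco AS Aattr] := hA.
have [S0 SD] := hS.
have JT j : J (j%:R * T) by exact: time_set_muln.
have SS j x : S (j.+1%:R * T) x = S T (S (j%:R * T) x).
  by rewrite SD// -natr1 mulrDl mul1r addrC.
have SST j x : S (j%:R * T) (S T x) = S (j.+1%:R * T) x.
  by rewrite SD// -natr1 mulrDl mul1r.
have Anear a e : 0 < e -> A a -> oneighborhood A e a.
  by move=> e0 Aa; exists a => //; rewrite /oball /= subrr rnorm0.
(* Two derivatives near [a] differ by at most twice [sigma / 16], and [mean_value] doubles this to
   the [sigma / 4] of [local_contraction]. Points outside [A] receive dummy values. *)
have /choice[dmM dmMP] : forall a, exists dmM : R * nat * R, A a ->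
    0 < dmM.1.1 /\ forall x, rnorm (a - x) < dmM.1.1 ->
    [/\ oneighborhood A delta0 x, (opnorm ('d (S T) x) <= dmM.2%:E)%E,
        approximable lambda ('d (S T) x) dmM.1.2 &
        forall w, rnorm ('d (S T) x w - 'd (S T) a w) <= sigma / 16 * rnorm w].
  move=> a; have [Aa|nAa] := pselect (A a); last by exists (0, 0%N, 0) => /nAa.
  have [K [C [_ Kco _ Cl KC]]] := hdec a (Anear _ _ hdelta0 Aa).
  have s16 : 0 < sigma / 16 by rewrite divr_gt0.
  have [d [m [M dmMP]]] := C1_local_bounds hdelta0 s16 Aa hC1
    (compact_perturbation_approximable Kco Cl KC).
  by exists (d, m, M).
have [e e0 [s sA es]] := uniform_neighborhood Aco (fun a Aa => (dmMP a Aa).1).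
have [M0 sM0] := seq_bounded (fun c => (dmM c).2) s.
have [n0' sn0'] := seq_bounded (fun c => (dmM c).1.2%:R : R) s.
pose n0 := Num.bound n0'.
have sn0 c : c \in s -> ((dmM c).1.2 <= n0)%N.
  move=> cs; rewrite -(ler_nat R); apply: le_trans (sn0' c cs) _.
  apply: ltW; apply: archi_boundP; exact: le_trans (sn0' c cs).
(* Requiring this for all [j] makes [B] invariant under [S T]; the case [j = 0] places it in the
   neighborhood, and invariance of [A] gives [AB]. *)
pose B := [set x | forall j, oneighborhood A e (S (j%:R * T) x)].
have AB : A `<=` B.
  move=> a Aa j; apply: Anear => //; rewrite -(AS _ (JT j)); by exists a.
have BA : B `<=` oneighborhood A e.
  by move=> x /(_ 0%N); rewrite mul0r S0.
have ST_B x : B x -> B (S T x) by move=> Bx j; rewrite SST.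
have SjB j x : B x -> B (S (j%:R * T) x).
  by move=> Bx; elim: j => [|j IH]; [rewrite mul0r S0|rewrite SS; exact: ST_B].
have B0 : B !=set0 by have [a Aa] := A0; exists a; exact: AB.
have Bloc x : B x -> [/\ oneighborhood A delta0 x,
    (opnorm ('d (S T) x) <= M0%:E)%E,
    exists2 m, (m <= n0)%N & approximable lambda ('d (S T) x) m &
    forall v, rnorm v < 2 * e ->
      rnorm (S T (x + v) - S T x - 'd (S T) x v) <= sigma / 4 * rnorm v].
  move=> /BA/es[c cs cx]; have [_ cP] := dmMP c (sA c cs).
  have [|xd xM xm xc] := cP x.
    by apply: cx; rewrite subrr rnorm0 mulr_gt0.
  split=> //.
  - by apply: le_trans xM _; rewrite lee_fin sM0.
  - by exists (dmM c).1.2; rewrite ?sn0.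
  - move=> v ve; rewrite (_ : sigma / 4 = 2 * (sigma / 8)); last by field.
    apply: mean_value => [|t t01 z]; first by rewrite divr_gt0.
    have [|zd _ _ zc] := cP z.
      apply: cx; rewrite /z opprD addrA subrr sub0r rnormN rnormZ.
      have /andP[t0 t1] := t01; rewrite ger0_norm//.
      by apply: le_lt_trans ve; rewrite ler_piMl// rnorm_ge0.
    split; first exact: (hC1 z zd).1.
    move=> w; have := rdistD ('d (S T) c w) ('d (S T) z w) ('d (S T) x w).
    rewrite (rdistC ('d (S T) c w)); have := zc w; have := xc w; lra.
have Bn0 y : B y -> exists2 m, (m <= n0)%N & approximable lambda ('d (S T) y) m.
  by case/Bloc.
have BM0 y : B y -> (opnorm ('d (S T) y) <= M0%:E)%E by case/Bloc.
have [n nE Bn] := ereal_sup_nu B0 Bn0.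
have [M M_ge0 ME] := ereal_sup_opnorm B0 BM0.
have BM y : B y -> (opnorm ('d (S T) y) <= M%:E)%E.
  by move=> By; rewrite -ME; apply: ereal_sup_ubound; exists y.
(* This base has no factor [Num.sqrt n%:R]; the weaker bound of the statement is derived at the
   end. *)
pose base := 1 + 8 * M / sigma; pose h := base ^+ (real_dim k * n).
have base1 : 1 <= base by rewrite lerDl divr_ge0 ?mulr_ge0// ltW.
have h1 : 1 <= h by rewrite exprn_ege1.
have [s0 [s0A As0]] := compact_finite_cover Aco (fun _ _ => e0).
have cov j : exists2 s, covers (S (j%:R * T) @` B) (q ^+ j * (2 * e)) s &
    (size s)%:R <= (size s0)%:R * h ^+ j.
  elim: j => [|j [sj [sjB Bsj] sizej]].
    exists s0; last by rewrite mulr1.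
    split=> [c /s0A/AB Bc|_ [y By <-]]; first by exists c => //; rewrite mul0r S0.
    rewrite mul0r S0 mul1r; have [a Aa ay] := BA y By.
    have [c cs ca] := As0 a Aa; exists c => //.
    have := rdistD a c y; move: ay ca; rewrite /oball /=; lra.
  have -> : S (j.+1%:R * T) @` B = S T @` (S (j%:R * T) @` B).
    by rewrite image_comp; apply: eq_imagel => x _; rewrite SS.
  have qj0 : 0 < q ^+ j by rewrite exprn_gt0.
  have qj1 : q ^+ j <= 1 by rewrite exprn_ile1// ltW.
  have [|s' s'cov s'size] := covers_image (f := S T) (e := q ^+ j.+1 * (2 * e)) (H := h) Bsj.
    move=> c G cs Gc.
    (* Centers belong to the image of [B], hence to [B], so the bounds [n] and [M] hold at each of
       them. *)
    have Bc : B c by have [x Bx <-] := sjB c cs; exact: SjB.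
    have [m mn cm] := Bn c Bc; have [_ _ _ cdiff] := Bloc c Bc.
    have r0 : 0 < q ^+ j * (2 * e) by rewrite !mulr_gt0.
    have Gball : G `<=` oball c (q ^+ j * (2 * e)) by move=> x /Gc[].
    have cdiffj v : rnorm v < q ^+ j * (2 * e) ->
        rnorm (S T (c + v) - S T c - 'd (S T) c v) <= sigma / 4 * rnorm v.
      move=> vr; apply: cdiff; apply: lt_le_trans vr _.
      by rewrite ler_piMl// mulr_ge0// ltW.
    have [s' s'cov s'size] :=
      local_contraction r0 sigma0 M_ge0 (BM c Bc) cm cdiffj Gball.
    exists s'; first by rewrite exprS -mulrA.
    by apply: le_trans s'size _; rewrite ler_weXn2l// leq_mul2l mn orbT.
  exists s' => //; apply: le_trans s'size _.
  rewrite exprS mulrCA; apply: ler_wpM2l => //; exact: le_trans h1.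
exists (2 * e), (size s0)%:R, h, B; split; [split=> //|split; [split=> //|]].
- by rewrite mulr_gt0.
- have [a /As0[c cs _]] := A0.
  by rewrite ltr0n; case: (s0) cs.
- have [b bP] := seq_bounded (fun c => rnorm c) s0.
  apply/rnorm_bounded_setP; exists (b + 2 * e) => y /BA[a Aa ay].
  have [c cs ca] := As0 a Aa; have := bP c cs.
  have := rnormB c (c - y); rewrite opprB addrCA subrr addr0.
  have := rdistD a c y; move: ay ca; rewrite /oball /=; lra.
(* Attraction is available for nonempty sets only, so the empty set is treated first. *)
- move=> G Gb; have [->|/set0P G0] := eqVneq G set0.
    exists 0; first by rewrite -(mul0r T); exact: (JT 0%N).
    by move=> t _ _; rewrite image_set0.
  have : nbhs (0%E : \bar R) [set y | (y < e%:E)%E].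
    apply: open_nbhs_nbhs; split; first exact: open_ereal_lt_ereal.
    by rewrite /= lte_fin.
  move=> /(Aattr G Gb G0)[N [_ NP]].
  (* The threshold [N] need not belong to [J]; a multiple of [T] beyond it does. After that time all
     further iterates stay near [A], which is membership in [B]. *)
  pose j := Num.bound (`|N| / T).
  have Nj : N < j%:R * T.
    rewrite -ltr_pdivrMr//; apply: le_lt_trans (archi_boundP _); last by rewrite divr_ge0// ltW.
    by rewrite ler_pM2r ?invr_gt0// ler_norm.
  have attr t : J t -> N < t -> forall x, G x -> oneighborhood A e (S t x).
    move=> Jt Nt x Gx; have /= sup_e := NP t Nt Jt.
    have : (distance (S t x) A < e%:E)%E.
      by apply: le_lt_trans sup_e; apply: ereal_sup_ubound; exists x.
    move=> /ereal_inf_lt[_ [a Aa <-]]; rewrite lte_fin => xa.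
    by exists a => //; rewrite /oball /= rdistC.
  exists (j%:R * T) => // t Jt jt _ [x Gx <-] i.
  rewrite SD//; apply: attr => //; first exact: time_setD.
  apply: (lt_le_trans Nj); apply: le_trans jt _.
  by rewrite lerDr mulr_ge0// ltW.
- by move=> x /Bloc[].
- by move=> _ [x Bx <-]; exact: ST_B.
- move=> j _; have [sj sjcov sjsize] := cov j.
  by apply: le_trans (covering_number_le sjcov) _; rewrite lee_fin.
exists n, M; split=> //.
(* For [n = 0] both sides are empty powers; otherwise [Num.sqrt n%:R >= 1] enlarges the base. *)
case: (n) @h {h1 cov} => [|n'] /=; rewrite /base; first by rewrite muln0.
apply: lerXn2r; rewrite ?nnegrE ?(le_trans _ base1)//.
  by rewrite addr_ge0// divr_ge0 ?mulr_ge0 ?sqrtr_ge0// ltW.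
rewrite lerD2l ler_pM2r ?invr_gt0// ler_wpM2r// ler_peMr//.
by rewrite -[leLHS]sqrtr1 ler_wsqrtr// ler1n.
Qed.
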